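(* For every integer $r\ge1$, \[ \lim_{n\to\infty}\frac{1}{n}\log P\left(\frac{S_{r+1,n}}{n}>y\right)=-I_r(y)\quad\text{for } y\in\left(\frac{1}{4^r},\frac{1}{2^r}\right), \] and \[ \lim_{n\to\infty}\frac{1}{n}\log P\left(\frac{S_{r+1,n}}{n}<y\right)=-I_r(y)\quad\text{for } y\in\left(0,\frac{1}{4^r}\right), \] where $I_r(y)=\sup_{\xi\in\mathbb{R}}\left(y\xi-\varphi^r(\xi)\right)$ is the Legendre transform of $\varphi^r$.
   Context: Let $\Omega_n$ be the set of rooted, planar, full binary trees with $n$ leaves, equipped with the uniform probability measure $P$ (the random binary tree model). Strahler ordering: leaves have order 1; an internal node whose children have different orders $r_1\ne r_2$ has order $\max\{r_1,r_2\}$; an internal node whose two children both have order $r$ has order $r+1$. A branch of order $r$ is a maximal connected path all of whose nodes have order $r$; $S_{r,n}(\tau)$ is the number of order-$r$ branches of $\tau\in\Omega_n$. Let $\varphi(\xi)=\frac{\xi}{4}+\log\cosh\frac{\xi}{4}$ and $\varphi^r$ its $r$-fold composition. *)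

(* Defs.v *)
From Stdlib Require Import Reals Lra Lia List Arith Bool.
Import ListNotations.
Open Scope R_scope.

Inductive tree : Type := Leaf : tree | Node : tree -> tree -> tree.

Fixpoint leaves (t : tree) : nat :=
  match t with Leaf => 1%nat | Node l r => (leaves l + leaves r)%nat end.

(** Enumeration of all trees with exactly [n] leaves (fuel [k] >= n suffices);
    [Omega n] lists each element of Omega_n exactly once. *)
Fixpoint gen (k n : nat) : list tree :=
  match k with
  | O => []
  | S k' =>
      if Nat.eqb n 1 then [Leaf]
      else flat_map (fun i =>
             flat_map (fun l => map (fun r => Node l r) (gen k' (n - i)))
                      (gen k' i))
           (seq 1 (n - 1))
  end.

Definition Omega (n : nat) : list tree := gen n n.

Definition prob (n : nat) (A : tree -> bool) : R :=
  INR (length (filter A (Omega n))) / INR (length (Omega n)).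

Fixpoint strahler (t : tree) : nat :=
  match t with
  | Leaf => 1%nat
  | Node l r =>
      let a := strahler l in let b := strahler r in
      if Nat.eqb a b then S a else Nat.max a b
  end.

(** Number of branches of order [r]: every maximal path of nodes of order [r]
    has a unique topmost node, namely a node of order [r] that is the root or
    whose parent has order different from [r].  [br r t p] counts such tops in
    [t] given the parent's order [p] (None for the root). *)
Fixpoint br (r : nat) (t : tree) (p : option nat) : nat :=
  let o := strahler t in
  ((if Nat.eqb o r && negb (match p with Some q => Nat.eqb q r | None => false end)
    then 1 else 0)
   + match t with
     | Leaf => 0
     | Node l rt => br r l (Some o) + br r rt (Some o)
     end)%nat.

Definition S_order (r : nat) (t : tree) : nat := br r t None.

Definition phi (xi : R) : R := xi / 4 + ln (cosh (xi / 4)).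

Fixpoint phi_iter (r : nat) (xi : R) : R :=
  match r with O => xi | S r' => phi (phi_iter r' xi) end.

Definition Legendre (r : nat) (y I : R) : Prop :=
  is_lub (fun z => exists xi : R, z = y * xi - phi_iter r xi) I.

Definition Rltb (a b : R) : bool := if Rlt_dec a b then true else false.

(* Main.v *)
Require Import Defs.
From Stdlib Require Import Reals Lra Lia List Arith Bool.
From Coquelicot Require Import Coquelicot.
Import ListNotations.
Open Scope R_scope.

(** Pruning (cutting all leaves and suppressing the resulting one-child nodes) lowers
    every Strahler order by one, and each tree with k leaves is the pruning of
    C(n-2, 2k-2) 2^(n-2k) trees with n leaves.  Hence the sums over Omega_n of
    exp (xi S_{r+1}) arise from those of exp (xi S_r) by a linear transform, and by the
    binomial theorem this transform turns exponential growth rate rho into 2 + sqrt rho.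
    Starting from exp (xi n) |Omega_n|, of growth rate 4 exp xi, and using
    2 + sqrt (4 exp x) = 4 exp (phi x), the normalised log-moment generating function of
    S_{r+1} converges to phi^r.  The tail rates then follow from the Gartner-Ellis
    argument: a Chernoff bound, and a change of measure by an exponential tilt slightly
    beyond the maximiser in the Legendre transform.  The lower tail is the upper tail
    of - S_{r+1}. *)

(** * Finite sums *)

Definition lsum {A : Type} (f : A -> R) (l : list A) : R :=
  fold_right (fun a s => f a + s) 0 l.

Lemma lsum_single {A : Type} (f : A -> R) (a : A) : lsum f [a] = f a.
Proof. apply Rplus_0_r. Qed.

Lemma lsum_cons {A : Type} (f : A -> R) (a : A) (l : list A) :
  lsum f (a :: l) = f a + lsum f l.
Proof. reflexivity. Qed.

Lemma lsum_app {A : Type} (f : A -> R) (l1 l2 : list A) :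
  lsum f (l1 ++ l2) = lsum f l1 + lsum f l2.
Proof. induction l1 as [|a l1 IH]; simpl; [lra | rewrite IH; lra]. Qed.

Lemma lsum_ext_in {A : Type} (f g : A -> R) (l : list A) :
  (forall a, In a l -> f a = g a) -> lsum f l = lsum g l.
Proof.
  induction l as [|a l IH]; simpl; intros H; [reflexivity|].
  rewrite H, IH; auto.
Qed.

Lemma lsum_le {A : Type} (f g : A -> R) (l : list A) :
  (forall a, In a l -> f a <= g a) -> lsum f l <= lsum g l.
Proof.
  induction l as [|a l IH]; simpl; intros H; [lra|].
  apply Rplus_le_compat; auto.
Qed.

Lemma lsum_zero {A : Type} (f : A -> R) (l : list A) :
  (forall a, In a l -> f a = 0) -> lsum f l = 0.
Proof.
  induction l as [|a l IH]; simpl; intros H; [reflexivity|].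
  rewrite H, IH; auto; lra.
Qed.

Lemma lsum_nonneg {A : Type} (f : A -> R) (l : list A) :
  (forall a, In a l -> 0 <= f a) -> 0 <= lsum f l.
Proof.
  intros H; rewrite <- (lsum_zero (fun _ : A => 0) l); [|reflexivity].
  now apply lsum_le.
Qed.

Lemma lsum_pos {A : Type} (f : A -> R) (l : list A) :
  l <> [] -> (forall a, 0 < f a) -> 0 < lsum f l.
Proof.
  destruct l as [|a l]; [congruence|]; intros _ H; simpl.
  apply Rplus_lt_le_0_compat; [apply H|].
  apply lsum_nonneg; intros; left; apply H.
Qed.

Lemma lsum_plus {A : Type} (f g : A -> R) (l : list A) :
  lsum (fun a => f a + g a) l = lsum f l + lsum g l.
Proof. induction l as [|a l IH]; simpl; [lra | rewrite IH; lra]. Qed.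

Lemma lsum_scal {A : Type} (c : R) (f : A -> R) (l : list A) :
  lsum (fun a => c * f a) l = c * lsum f l.
Proof. induction l as [|a l IH]; simpl; [lra | rewrite IH; lra]. Qed.

Lemma lsum_one {A : Type} (l : list A) : lsum (fun _ => 1) l = INR (length l).
Proof.
  induction l as [|a l IH]; [reflexivity|].
  change (length (a :: l)) with (S (length l)); rewrite S_INR, <- IH; simpl; lra.
Qed.

Lemma lsum_swap {A B : Type} (f : A -> B -> R) (l : list A) (m : list B) :
  lsum (fun a => lsum (fun b => f a b) m) l =
  lsum (fun b => lsum (fun a => f a b) l) m.
Proof.
  induction l as [|a l IH]; simpl.
  - symmetry; now apply lsum_zero.
  - now rewrite IH, lsum_plus.
Qed.

Lemma lsum_flat_map {A B : Type} (f : B -> R) (g : A -> list B) (l : list A) :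
  lsum f (flat_map g l) = lsum (fun a => lsum f (g a)) l.
Proof. induction l as [|a l IH]; simpl; [reflexivity|]. now rewrite lsum_app, IH. Qed.

Lemma lsum_map {A B : Type} (f : B -> R) (g : A -> B) (l : list A) :
  lsum f (map g l) = lsum (fun a => f (g a)) l.
Proof. induction l as [|a l IH]; simpl; congruence. Qed.

Lemma lsum_filter {A : Type} (p : A -> bool) (l : list A) :
  INR (length (filter p l)) = lsum (fun a => if p a then 1 else 0) l.
Proof.
  rewrite <- lsum_one; induction l as [|a l IH]; simpl; [reflexivity|].
  destruct (p a); simpl; rewrite IH; lra.
Qed.

Lemma lsum_seq_S (f : nat -> R) (s n : nat) :
  lsum f (seq s (S n)) = lsum f (seq s n) + f (s + n)%nat.
Proof. rewrite seq_S, lsum_app; simpl; lra. Qed.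

Lemma lsum_seq_shift (f : nat -> R) (s n : nat) :
  lsum f (seq (S s) n) = lsum (fun i => f (S i)) (seq s n).
Proof. now rewrite <- seq_shift, lsum_map. Qed.

(** Both sides run over the pairs of positive integers with sum at most [K]; the right side groups
    them by that sum. With [i] and [j] as subtree sizes, this collects trees by total size. *)
Lemma lsum_triangle (G : nat -> nat -> R) (K : nat) :
  lsum (fun i => lsum (fun j => G i j) (seq 1 (K - i))) (seq 1 K) =
  lsum (fun k => lsum (fun i => G i (k - i)%nat) (seq 1 (k - 1))) (seq 1 K).
Proof.
  induction K as [|K IH]; [reflexivity|].
  rewrite !lsum_seq_S.
  replace (S K - (1 + K))%nat with 0%nat by lia.
  replace (1 + K - 1)%nat with K by lia.
  rewrite <- IH, <- lsum_plus, Rplus_0_r.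
  apply lsum_ext_in; intros i Hi; apply in_seq in Hi.
  replace (S K - i)%nat with (S (K - i)) by lia.
  rewrite lsum_seq_S; f_equal; f_equal; lia.
Qed.

(** * Enumeration and pruning of trees *)

Lemma gen_S (k n : nat) : gen (S k) n =
  if Nat.eqb n 1 then [Leaf]
  else flat_map (fun i => flat_map (fun l => map (fun r => Node l r) (gen k (n - i)))
                                   (gen k i)) (seq 1 (n - 1)).
Proof. reflexivity. Qed.

Lemma gen_fuel (k n : nat) : (n <= k)%nat -> gen k n = Omega n.
Proof.
  unfold Omega.
  (* Strengthened for induction on a bound [m] for the fuel, because the two sides recur with
     different fuels. *)
  cut (forall m k n, n <= k -> k <= m -> gen k n = gen n n)%nat.
  { intros H Hn; now apply (H k). }
  clear k n; induction m as [|m IH]; intros k n Hn Hk.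
  - replace k with 0%nat by lia; replace n with 0%nat by lia; reflexivity.
  - destruct n as [|n].
    + destruct k; reflexivity.
    + destruct k as [|k]; [lia|]; rewrite !gen_S.
      destruct (Nat.eqb_spec (S n) 1) as [|Hn0]; [reflexivity|].
      rewrite !flat_map_concat_map; f_equal; apply map_ext_in.
      intros i Hi; apply in_seq in Hi.
      rewrite (IH k i), (IH n i), (IH k (S n - i)%nat), (IH n (S n - i)%nat) by lia.
      reflexivity.
Qed.

Lemma Omega_step (n : nat) : (2 <= n)%nat ->
  Omega n = flat_map (fun i =>
     flat_map (fun l => map (fun r => Node l r) (Omega (n - i))) (Omega i))
     (seq 1 (n - 1)).
Proof.
  intros Hn; destruct n as [|n]; [lia|].
  unfold Omega at 1; rewrite gen_S.
  destruct (Nat.eqb_spec (S n) 1) as [|Hn0]; [lia|].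
  rewrite !flat_map_concat_map; f_equal; apply map_ext_in.
  intros i Hi; apply in_seq in Hi.
  rewrite !gen_fuel by lia; reflexivity.
Qed.

Lemma Omega_1 : Omega 1 = [Leaf].
Proof. reflexivity. Qed.

Lemma lsum_Omega (F : tree -> R) (n : nat) : (2 <= n)%nat ->
  lsum F (Omega n) =
  lsum (fun i => lsum (fun l => lsum (fun r => F (Node l r)) (Omega (n - i)))
     (Omega i)) (seq 1 (n - 1)).
Proof.
  intros Hn; rewrite Omega_step, lsum_flat_map by assumption.
  apply lsum_ext_in; intros i _; rewrite lsum_flat_map.
  apply lsum_ext_in; intros l _; apply lsum_map.
Qed.

Lemma leaves_Omega (n : nat) (t : tree) : In t (Omega n) -> leaves t = n.
Proof.
  revert t; induction n as [n IH] using (well_founded_induction lt_wf); intros t Ht.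
  destruct n as [|[|n]]; [easy | destruct Ht as [<-|[]]; reflexivity |].
  rewrite Omega_step in Ht by lia.
  apply in_flat_map in Ht as [i [Hi Ht]]; apply in_seq in Hi.
  apply in_flat_map in Ht as [l [Hl Ht]].
  apply in_map_iff in Ht as [r [<- Hr]].
  apply IH in Hl; [|lia]; apply IH in Hr; [|lia]; simpl; lia.
Qed.

Lemma Omega_nonempty (n : nat) : (1 <= n)%nat -> Omega n <> [].
Proof.
  induction n as [|n IH]; [lia|]; intros _.
  destruct n as [|n]; [discriminate|].
  destruct (Omega (S n)) as [|t L] eqn:E; [now elim IH; [lia|]|].
  assert (H : In (Node Leaf t) (Omega (S (S n)))).
  { rewrite Omega_step by lia.
    apply in_flat_map; exists 1%nat; split; [apply in_seq; lia|].
    apply in_flat_map; exists Leaf; split; [now left|].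
    apply in_map_iff; exists t; split; [reflexivity|].
    replace (S (S n) - 1)%nat with (S n) by lia; rewrite E; now left. }
  intros E2; rewrite E2 in H; destruct H.
Qed.

(** A cherry becomes a leaf, and a node with exactly one leaf child is suppressed together with that
    leaf. The value at [Leaf] only makes the function total, whence the side conditions [t <> Leaf]
    below. *)
Fixpoint prune (t : tree) : tree :=
  match t with
  | Leaf => Leaf
  | Node Leaf Leaf => Leaf
  | Node Leaf r => prune r
  | Node l Leaf => prune l
  | Node l r => Node (prune l) (prune r)
  end.

Lemma prune_Leaf_l (t : tree) : t <> Leaf -> prune (Node Leaf t) = prune t.
Proof. now destruct t. Qed.

Lemma prune_Leaf_r (t : tree) : t <> Leaf -> prune (Node t Leaf) = prune t.
Proof. now destruct t. Qed.

Lemma prune_Node (l r : tree) : l <> Leaf -> r <> Leaf ->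
  prune (Node l r) = Node (prune l) (prune r).
Proof. now destruct l, r. Qed.

Lemma Leaf_dec (t : tree) : {t = Leaf} + {t <> Leaf}.
Proof. destruct t; [now left | now right]. Qed.

Lemma strahler_pos (t : tree) : (1 <= strahler t)%nat.
Proof.
  induction t as [|l IHl r IHr]; simpl; [lia|].
  destruct (Nat.eqb _ _); lia.
Qed.

(** A leaf beside a subtree of order at least 2 does not affect the maximum, so suppressing its
    parent changes no order. If neither child is a leaf, both orders drop by one and their
    comparison is unchanged. *)
Lemma strahler_prune (t : tree) : t <> Leaf -> strahler t = S (strahler (prune t)).
Proof.
  induction t as [|l IHl r IHr]; intros Ht; [easy|].
  destruct (Leaf_dec l) as [->|Hl], (Leaf_dec r) as [->|Hr].
  - reflexivity.
  - rewrite prune_Leaf_l, <- IHr by assumption; specialize (IHr Hr).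
    pose proof (strahler_pos (prune r)).
    change (strahler (Node Leaf r)) with
      (if Nat.eqb 1 (strahler r) then 2%nat else Nat.max 1 (strahler r)).
    destruct (Nat.eqb_spec 1 (strahler r)); lia.
  - rewrite prune_Leaf_r, <- IHl by assumption; specialize (IHl Hl).
    pose proof (strahler_pos (prune l)); simpl.
    destruct (Nat.eqb_spec (strahler l) 1); lia.
  - rewrite prune_Node by assumption; simpl.
    rewrite IHl, IHr by assumption; simpl.
    destruct (Nat.eqb _ _); reflexivity.
Qed.

Lemma br_Leaf (r : nat) (p : option nat) : br (S (S r)) Leaf p = 0%nat.
Proof. reflexivity. Qed.

Lemma br_Node (r : nat) (u v : tree) (p : option nat) :
  br r (Node u v) p =
  ((if Nat.eqb (strahler (Node u v)) r &&
       negb (match p with Some q => Nat.eqb q r | None => false end) then 1 else 0)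
   + (br r u (Some (strahler (Node u v))) + br r v (Some (strahler (Node u v)))))%nat.
Proof. reflexivity. Qed.

(** Giving the root its own order as parent order cancels the contribution of the root alone. This
    transfers the parent order of a suppressed node to its surviving child, which has the same order
    as that node. *)
Lemma br_same (r : nat) (t : tree) (p : option nat) :
  br r t p =
  ((if Nat.eqb (strahler t) r &&
       negb (match p with Some q => Nat.eqb q r | None => false end) then 1 else 0)
   + br r t (Some (strahler t)))%nat.
Proof.
  assert (H : forall o : nat, (if Nat.eqb o r && negb (Nat.eqb o r) then 1 else 0)%nat = 0%nat)
    by (intros o; now destruct (Nat.eqb o r)).
  destruct t as [|u v].
  - change (br r Leaf (Some (strahler Leaf))) with
      ((if Nat.eqb 1 r && negb (Nat.eqb 1 r) then 1 else 0) + 0)%nat.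
    now rewrite H.
  - now rewrite !br_Node, H.
Qed.

(** Deleted leaves have order 1 and so contribute nothing at order [S (S r)]; a suppressed node
    continues the branch of its surviving child. The parent order is shifted along with all the
    others. *)
Lemma br_prune (r : nat) (t : tree) (p : option nat) : t <> Leaf ->
  br (S (S r)) t (option_map S p) = br (S r) (prune t) p.
Proof.
  revert p; induction t as [|u IHu v IHv]; intros p Ht; [easy|].
  rewrite br_Node, (strahler_prune (Node u v)) by discriminate.
  destruct (Leaf_dec u) as [->|Hu], (Leaf_dec v) as [->|Hv].
  - destruct p; reflexivity.
  - rewrite prune_Leaf_l, br_Leaf by assumption.
    specialize (IHv (Some (strahler (prune v))) Hv); simpl in IHv.
    rewrite IHv, (br_same (S r) (prune v) p); destruct p; reflexivity.
  - rewrite prune_Leaf_r, br_Leaf by assumption.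
    specialize (IHu (Some (strahler (prune u))) Hu); simpl in IHu.
    rewrite IHu, (br_same (S r) (prune u) p), Nat.add_0_r; destruct p; reflexivity.
  - rewrite prune_Node by assumption.
    specialize (IHu (Some (strahler (prune (Node u v)))) Hu).
    specialize (IHv (Some (strahler (prune (Node u v)))) Hv).
    rewrite prune_Node in IHu, IHv by assumption; cbn [option_map] in IHu, IHv.
    rewrite IHu, IHv, br_Node; destruct p; reflexivity.
Qed.

Lemma S_order_prune (r : nat) (t : tree) : t <> Leaf ->
  S_order (S (S r)) t = S_order (S r) (prune t).
Proof. exact (br_prune r t None). Qed.

(** Internal nodes have order at least 2, so each leaf is a branch of order 1 by itself. *)
Lemma S_order_1 (t : tree) : S_order 1 t = leaves t.
Proof.
  unfold S_order.
  cut (forall p, p <> Some 1%nat -> br 1 t p = leaves t); [intros H; now apply H|].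
  induction t as [|u IHu v IHv]; intros p Hp.
  - destruct p as [[|[|q]]|]; try reflexivity; congruence.
  - assert (H : (2 <= strahler (Node u v))%nat).
    { pose proof (strahler_pos (prune (Node u v))).
      rewrite strahler_prune by discriminate; lia. }
    rewrite br_Node.
    destruct (Nat.eqb_spec (strahler (Node u v)) 1) as [E|E]; [lia|].
    assert (Hs : Some (strahler (Node u v)) <> Some 1%nat) by congruence.
    rewrite IHu, IHv by assumption; reflexivity.
Qed.

(** * The pruning transform *)

(* [wbin m i] is the binomial weight C(m, i) 2^(m - i). *)
Fixpoint wbin (m i : nat) : R :=
  match m with
  | O => match i with O => 1 | S _ => 0 end
  | S m' => 2 * wbin m' i + match i with O => 0 | S i' => wbin m' i' end
  end.

Lemma wbin_nonneg (m i : nat) : 0 <= wbin m i.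
Proof.
  revert i; induction m as [|m IH]; intros [|i]; simpl; try lra.
  - specialize (IH 0%nat); lra.
  - pose proof (IH i); pose proof (IH (S i)); lra.
Qed.

Lemma wbin_zero (m i : nat) : (m < i)%nat -> wbin m i = 0.
Proof.
  revert i; induction m as [|m IH]; intros [|i] H; simpl; try lia; [reflexivity|].
  rewrite !IH by lia; lra.
Qed.

(** Mark [j + j' + 1] of [m] positions and give each other position one of two colours; cutting at
    the mark number [j + 1], in position [i], leaves two independent words of lengths [i] and
    [m - 1 - i]. The induction removes the first position. *)
Lemma wbin_convolution (m j j' : nat) :
  lsum (fun i => wbin i j * wbin (m - 1 - i) j') (seq 0 m) = wbin m (j + j' + 1).
Proof.
  revert j; induction m as [|m IH]; intros j.
  - now replace (j + j' + 1)%nat with (S (j + j')) by lia.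
  - change (seq 0 (S m)) with (0%nat :: seq 1 m).
    rewrite lsum_cons, lsum_seq_shift.
    replace (S m - 1 - 0)%nat with m by lia.
    rewrite (lsum_ext_in _ (fun i => 2 * (wbin i j * wbin (m - 1 - i) j')
       + match j with O => 0 | S h => wbin i h * wbin (m - 1 - i) j' end)).
    2:{ intros i Hi; apply in_seq in Hi.
        replace (S m - 1 - S i)%nat with (m - 1 - i)%nat by lia.
        destruct j; simpl; ring. }
    rewrite lsum_plus, lsum_scal, IH.
    replace (j + j' + 1)%nat with (S (j + j')) by lia; simpl.
    destruct j as [|j].
    + rewrite (lsum_zero (fun _ => 0)) by reflexivity; simpl; ring.
    + rewrite IH; replace (j + j' + 1)%nat with (S j + j')%nat by lia; ring.
Qed.

Lemma Omega_not_Leaf (n : nat) (t : tree) : (2 <= n)%nat -> In t (Omega n) -> t <> Leaf.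
Proof. intros Hn Ht ->; apply leaves_Omega in Ht; simpl in Ht; lia. Qed.

(** Split at the root of a tree with at least 3 leaves: either exactly one child is a leaf, on one
    of two sides, and pruning discards it, or pruning acts on both children separately. *)
Lemma lsum_prune_step (F : tree -> R) (m : nat) :
  lsum (fun t => F (prune t)) (Omega (m + 3)) =
  2 * lsum (fun t => F (prune t)) (Omega (m + 2)) +
  lsum (fun i => lsum (fun l => lsum (fun r => F (Node (prune l) (prune r)))
     (Omega (m + 1 - i))) (Omega (i + 2))) (seq 0 m).
Proof.
  rewrite lsum_Omega by lia.
  replace (m + 3 - 1)%nat with (S (S m)) by lia.
  rewrite lsum_seq_S.
  change (seq 1 (S m)) with (1%nat :: seq 2 m).
  rewrite lsum_cons, !lsum_seq_shift.
  replace (m + 3 - 1)%nat with (m + 2)%nat by lia.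
  replace (m + 3 - (1 + S m))%nat with 1%nat by lia.
  replace (1 + S m)%nat with (m + 2)%nat by lia.
  rewrite !Omega_1, lsum_single.
  rewrite (lsum_ext_in (fun r => F (prune (Node Leaf r))) (fun t => F (prune t))).
  2:{ intros t Ht; apply Omega_not_Leaf in Ht; [|lia]; now rewrite prune_Leaf_l. }
  rewrite (lsum_ext_in (fun l => lsum (fun r => F (prune (Node l r))) [Leaf])
             (fun t => F (prune t)) (Omega (m + 2))).
  2:{ intros t Ht; apply Omega_not_Leaf in Ht; [|lia].
      now rewrite lsum_single, prune_Leaf_r. }
  match goal with |- ?a + ?b + ?c = 2 * _ + ?d => cut (b = d); [intros ->; ring|] end.
  apply lsum_ext_in; intros i Hi; apply in_seq in Hi.
  replace (S (S i)) with (i + 2)%nat by lia.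
  replace (m + 3 - (i + 2))%nat with (m + 1 - i)%nat by lia.
  apply lsum_ext_in; intros l Hl; apply lsum_ext_in; intros r Hr.
  now rewrite prune_Node by (eapply Omega_not_Leaf; [|eassumption]; lia).
Qed.

(* Every tree with k leaves is the pruning of exactly [wbin (n-2) (2k-2)] trees with
   n leaves. *)
Lemma lsum_prune (F : tree -> R) (n K : nat) : (2 <= n)%nat -> (n <= K)%nat ->
  lsum (fun t => F (prune t)) (Omega n) =
  lsum (fun k => wbin (n - 2) (2 * k - 2) * lsum F (Omega k)) (seq 1 K).
Proof.
  revert F; induction n as [n IH] using (well_founded_induction lt_wf).
  intros F Hn HK.
  destruct (Nat.eq_dec n 2) as [->|Hn2].
  - destruct K as [|K]; [lia|].
    change (seq 1 (S K)) with (1%nat :: seq 2 K).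
    rewrite lsum_cons, (lsum_zero _ (seq 2 K)).
    + rewrite Omega_1; simpl; ring.
    + intros k Hk; apply in_seq in Hk.
      rewrite wbin_zero by lia; ring.
  - replace n with ((n - 3) + 3)%nat by lia.
    set (m := (n - 3)%nat) in *.
    rewrite lsum_prune_step, (IH (m + 2)%nat) by lia.
    (* The sum of [F] over trees whose root has subtrees with [k1] and [k2] leaves. The induction
       hypothesis is applied to both subtrees with the common bound [K], so that the sums can be
       interchanged. *)
    set (G := fun k1 k2 => lsum (fun l => lsum (fun r => F (Node l r)) (Omega k2)) (Omega k1)).
    rewrite (lsum_ext_in _ (fun i => lsum (fun k1 => lsum (fun k2 =>
       (wbin i (2 * k1 - 2) * wbin (m - 1 - i) (2 * k2 - 2)) * G k1 k2) (seq 1 K)) (seq 1 K))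
       (seq 0 m)).
    2:{ intros i Hi; apply in_seq in Hi.
        rewrite (IH (i + 2)%nat ltac:(lia)
          (fun l => lsum (fun r => F (Node l (prune r))) (Omega (m + 1 - i)))) by lia.
        apply lsum_ext_in; intros k1 _.
        replace (i + 2 - 2)%nat with i by lia.
        rewrite (lsum_ext_in _ (fun l => lsum (fun k2 =>
           wbin (m - 1 - i) (2 * k2 - 2) * lsum (fun r => F (Node l r)) (Omega k2)) (seq 1 K))).
        2:{ intros l _.
            rewrite (IH (m + 1 - i)%nat ltac:(lia) (fun r => F (Node l r))) by lia.
            now replace (m + 1 - i - 2)%nat with (m - 1 - i)%nat by lia. }
        rewrite lsum_swap, <- lsum_scal.
        apply lsum_ext_in; intros k2 _.
        rewrite lsum_scal; unfold G; ring. }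
    (* Summing first over the split [i] lets the convolution identity merge the two weights into a
       single one with lower index [2 * (k1 + k2) - 3]. *)
    set (A0 := 2 * lsum _ _); rewrite lsum_swap.
    rewrite (lsum_ext_in _ (fun k1 => lsum (fun k2 =>
       wbin m (2 * (k1 + k2) - 3) * G k1 k2) (seq 1 (K - k1))) (seq 1 K)).
    2:{ intros k1 Hk1; apply in_seq in Hk1; cbv beta.
        rewrite lsum_swap.
        rewrite (lsum_ext_in _ (fun k2 => wbin m (2 * (k1 + k2) - 3) * G k1 k2)).
        2:{ intros k2 Hk2; apply in_seq in Hk2.
            rewrite (lsum_ext_in _ (fun i => G k1 k2 *
              (wbin i (2 * k1 - 2) * wbin (m - 1 - i) (2 * k2 - 2)))) by (intros; ring).
            rewrite lsum_scal, wbin_convolution, Rmult_comm; f_equal; f_equal; lia. }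
        (* Pairs with [k1 + k2 > K] have weight zero, since then [2 * (k1 + k2) - 3] exceeds [m]. *)
        replace K with (K - k1 + k1)%nat at 1 by lia.
        rewrite seq_app, lsum_app, (lsum_zero _ (seq (1 + (K - k1)) k1)); [ring|].
        intros k2 Hk2; apply in_seq in Hk2.
        rewrite wbin_zero by lia; ring. }
    rewrite (lsum_triangle (fun k1 k2 => wbin m (2 * (k1 + k2) - 3) * G k1 k2)).
    unfold A0; rewrite <- lsum_scal, <- lsum_plus.
    apply lsum_ext_in; intros k Hk; apply in_seq in Hk.
    rewrite (lsum_ext_in _ (fun k1 => wbin m (2 * k - 3) * G k1 (k - k1)%nat)).
    2:{ intros k1 Hk1; apply in_seq in Hk1.
        now replace (k1 + (k - k1))%nat with k by lia. }
    rewrite lsum_scal.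
    replace (m + 2 - 2)%nat with m by lia.
    replace (m + 3 - 2)%nat with (S m) by lia.
    (* What remains is the Pascal recursion at lower index [2 * k - 2]; for [k = 1] that index is 0
       and there is no pair of subtrees. *)
    destruct (Nat.eq_dec k 1) as [->|Hk1].
    + simpl; ring.
    + rewrite (lsum_Omega F k) by lia.
      replace (2 * k - 2)%nat with (S (2 * k - 3)) by lia.
      simpl wbin; unfold G; ring.
Qed.

(** The even and odd parts of the binomial expansion of [(2 + w) ^ m], complete once [K > m].
    Pruning weights have even lower index; the odd part enters through the Pascal recursion. *)
Definition wbin_even (K m : nat) (w : R) : R :=
  lsum (fun k => wbin m (2 * k) * w ^ (2 * k)) (seq 0 K).

Definition wbin_odd (K m : nat) (w : R) : R :=
  lsum (fun k => wbin m (S (2 * k)) * w ^ S (2 * k)) (seq 0 K).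

Lemma wbin_even_S (K m : nat) (w : R) : (m < K)%nat ->
  wbin_even K (S m) w = 2 * wbin_even K m w + w * wbin_odd K m w.
Proof.
  intros H; destruct K as [|K]; [lia|].
  unfold wbin_odd; rewrite lsum_seq_S.
  rewrite (wbin_zero m (S (2 * (0 + K)))) by lia.
  unfold wbin_even; change (seq 0 (S K)) with (0%nat :: seq 1 K).
  rewrite !lsum_cons, !lsum_seq_shift, Rmult_plus_distr_l, <- !lsum_scal.
  rewrite Rmult_0_l, Rplus_0_r, <- !lsum_scal, Rplus_assoc, <- lsum_plus.
  simpl wbin at 1; simpl (w ^ (2 * 0)); f_equal; [simpl; ring|].
  apply lsum_ext_in; intros k _.
  replace (2 * S k)%nat with (S (S (2 * k))) by lia; simpl; ring.
Qed.

Lemma wbin_odd_S (K m : nat) (w : R) :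
  wbin_odd K (S m) w = 2 * wbin_odd K m w + w * wbin_even K m w.
Proof.
  unfold wbin_odd, wbin_even; rewrite <- !lsum_scal, <- lsum_plus.
  apply lsum_ext_in; intros k _.
  change (wbin (S m) (S (2 * k))) with (2 * wbin m (S (2 * k)) + wbin m (2 * k)).
  simpl pow; ring.
Qed.

Lemma wbin_even_add_odd (K m : nat) (w : R) : (m < K)%nat ->
  wbin_even K m w + wbin_odd K m w = (2 + w) ^ m.
Proof.
  induction m as [|m IH]; intros H.
  - unfold wbin_even, wbin_odd; destruct K as [|K]; [lia|].
    rewrite (lsum_zero (fun k => wbin 0 (S (2 * k)) * _)) by (intros; simpl; ring).
    change (seq 0 (S K)) with (0%nat :: seq 1 K).
    rewrite lsum_cons, lsum_zero; [simpl; ring|].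
    intros k Hk; apply in_seq in Hk; rewrite wbin_zero by lia; ring.
  - rewrite wbin_even_S, wbin_odd_S by lia; simpl; rewrite <- IH by lia; ring.
Qed.

Lemma wbin_even_nonneg (K m : nat) (w : R) : 0 <= w -> 0 <= wbin_even K m w.
Proof.
  intros; apply lsum_nonneg; intros.
  apply Rmult_le_pos; [apply wbin_nonneg | now apply pow_le].
Qed.

Lemma wbin_odd_nonneg (K m : nat) (w : R) : 0 <= w -> 0 <= wbin_odd K m w.
Proof.
  intros; apply lsum_nonneg; intros.
  apply Rmult_le_pos; [apply wbin_nonneg | now apply pow_le].
Qed.

Lemma wbin_even_le (K m : nat) (w : R) : (m < K)%nat -> 0 <= w ->
  wbin_even K m w <= (2 + w) ^ m.
Proof.
  intros H Hw; rewrite <- (wbin_even_add_odd K) by assumption.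
  pose proof (wbin_odd_nonneg K m w Hw); lra.
Qed.

(** One Pascal step gives even part [2 * E + w * O], which is at least [Rmin 2 w * (E + O)]. So the
    even part keeps a fixed proportion of the whole expansion. *)
Lemma wbin_even_ge (K m : nat) (w : R) : (m < K)%nat -> 0 < w ->
  Rmin 2 w / (2 + w) * (2 + w) ^ m <= wbin_even K m w.
Proof.
  intros H Hw.
  pose proof (Rmin_l 2 w); pose proof (Rmin_r 2 w).
  destruct m as [|m].
  - pose proof (wbin_even_add_odd K 0 w H) as E.
    replace (wbin_odd K 0 w) with 0 in E
      by (symmetry; apply lsum_zero; intros; simpl; ring).
    simpl in E |- *; rewrite Rplus_0_r in E; rewrite E, Rmult_1_r.
    apply Rmult_le_reg_r with (2 + w); [lra|].
    unfold Rdiv; rewrite Rmult_assoc, Rinv_l; lra.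
  - rewrite wbin_even_S by lia.
    replace (Rmin 2 w / (2 + w) * (2 + w) ^ S m) with (Rmin 2 w * (2 + w) ^ m)
      by (simpl; field; lra).
    rewrite <- (wbin_even_add_odd K m w) by lia.
    pose proof (wbin_even_nonneg K m w ltac:(lra)).
    pose proof (wbin_odd_nonneg K m w ltac:(lra)).
    rewrite Rmult_plus_distr_l.
    apply Rplus_le_compat; now apply Rmult_le_compat_r.
Qed.

(** * Exponential growth rates *)

Definition growth_ge (z : nat -> R) (rho : R) : Prop :=
  exists c, 0 < c /\ forall n, (1 <= n)%nat -> c * rho ^ n <= z n.

Definition growth_le (z : nat -> R) (rho : R) : Prop :=
  exists c, 0 < c /\ forall n, (1 <= n)%nat -> z n <= c * rho ^ n.

(** The bounds are asked only strictly away from [rho], which leaves room for subexponential factors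
    such as the power of n in the asymptotics of Catalan numbers. *)
Definition growth (z : nat -> R) (rho : R) : Prop :=
  (forall s, 0 < s < rho -> growth_ge z s) /\ (forall s, rho < s -> growth_le z s).

(** The weights describe trees with at least 2 leaves. At [n = 1] positivity is enough, since a
    multiplicative constant absorbs that value. *)
Definition prune_transform (z z' : nat -> R) : Prop :=
  0 < z' 1%nat /\
  forall n, (2 <= n)%nat ->
    z' n = lsum (fun k => wbin (n - 2) (2 * k - 2) * z k) (seq 1 n).

(** Writing the rate as [w * w] turns its powers into even powers of [w], so the transform of a
    geometric sequence is an even part of [(2 + w) ^ (n - 2)]. *)
Lemma lsum_wbin_pow (n : nat) (c w : R) :
  lsum (fun k => wbin (n - 2) (2 * k - 2) * (c * (w * w) ^ k)) (seq 1 n) =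
  c * (w * w) * wbin_even n (n - 2) w.
Proof.
  unfold wbin_even; rewrite lsum_seq_shift, <- lsum_scal.
  apply lsum_ext_in; intros k _.
  replace (2 * S k - 2)%nat with (2 * k)%nat by lia.
  rewrite pow_mult; replace (w ^ 2) with (w * w) by ring; simpl; ring.
Qed.

Lemma growth_ge_mono (z : nat -> R) (s rho : R) :
  0 <= s <= rho -> growth_ge z rho -> growth_ge z s.
Proof.
  intros Hs [c [Hc H]]; exists c; split; [assumption|]; intros n Hn.
  eapply Rle_trans; [|now apply H].
  apply Rmult_le_compat_l; [lra|]; now apply pow_incr.
Qed.

Lemma growth_le_mono (z : nat -> R) (s rho : R) :
  0 <= rho <= s -> growth_le z rho -> growth_le z s.
Proof.
  intros Hs [c [Hc H]]; exists c; split; [assumption|]; intros n Hn.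
  eapply Rle_trans; [now apply H|].
  apply Rmult_le_compat_l; [lra|]; now apply pow_incr.
Qed.

Lemma prune_transform_ge (z z' : nat -> R) (w : R) : prune_transform z z' ->
  0 < w -> growth_ge z (w * w) -> growth_ge z' (2 + w).
Proof.
  intros [Hz1 Hz] Hw [c [Hc H]].
  set (kap := Rmin 2 w / (2 + w)).
  assert (Hkap : 0 < kap)
    by (apply Rdiv_lt_0_compat; [apply Rmin_glb_lt|]; lra).
  (* The division by [(2 + w) ^ 2] makes up for the exponent [n - 2]; the minimum taken below also
     covers [n = 1]. *)
  set (c' := c * (w * w) * (kap / (2 + w) ^ 2)).
  assert (Hc' : 0 < c').
  { unfold c'; apply Rmult_lt_0_compat; [apply Rmult_lt_0_compat; nra|].
    apply Rdiv_lt_0_compat; [assumption | apply pow_lt; lra]. }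
  exists (Rmin c' (z' 1%nat / (2 + w))); split.
  - apply Rmin_glb_lt; [assumption|]; apply Rdiv_lt_0_compat; lra.
  - intros n Hn; destruct (Nat.eq_dec n 1) as [->|Hn1].
    + rewrite pow_1; apply Rle_trans with (z' 1%nat / (2 + w) * (2 + w)).
      * apply Rmult_le_compat_r; [lra | apply Rmin_r].
      * right; field; lra.
    + apply Rle_trans with (c' * (2 + w) ^ n).
      { apply Rmult_le_compat_r; [apply pow_le; lra | apply Rmin_l]. }
      rewrite Hz by lia.
      apply Rle_trans with
        (lsum (fun k => wbin (n - 2) (2 * k - 2) * (c * (w * w) ^ k)) (seq 1 n)).
      * rewrite lsum_wbin_pow.
        replace (c' * (2 + w) ^ n) with (c * (w * w) * (kap * (2 + w) ^ (n - 2))).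
        { apply Rmult_le_compat_l; [apply Rmult_le_pos; nra|].
          apply wbin_even_ge; [lia | assumption]. }
        replace n with (n - 2 + 2)%nat at 2 by lia.
        unfold c'; rewrite pow_add; field; lra.
      * apply lsum_le; intros k Hk; apply in_seq in Hk.
        apply Rmult_le_compat_l; [apply wbin_nonneg | apply H; lia].
Qed.

Lemma prune_transform_le (z z' : nat -> R) (w : R) : prune_transform z z' ->
  0 < w -> growth_le z (w * w) -> growth_le z' (2 + w).
Proof.
  intros [Hz1 Hz] Hw [c [Hc H]].
  set (c' := c * (w * w) / (2 + w) ^ 2).
  assert (Hc' : 0 < c')
    by (apply Rdiv_lt_0_compat; [repeat apply Rmult_lt_0_compat | apply pow_lt]; lra).
  exists (Rmax c' (z' 1%nat / (2 + w))); split.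
  - eapply Rlt_le_trans; [exact Hc' | apply Rmax_l].
  - intros n Hn; destruct (Nat.eq_dec n 1) as [->|Hn1].
    + rewrite pow_1; apply Rle_trans with (z' 1%nat / (2 + w) * (2 + w)).
      * right; field; lra.
      * apply Rmult_le_compat_r; [lra | apply Rmax_r].
    + apply Rle_trans with (c' * (2 + w) ^ n).
      2:{ apply Rmult_le_compat_r; [apply pow_le; lra | apply Rmax_l]. }
      rewrite Hz by lia.
      apply Rle_trans with
        (lsum (fun k => wbin (n - 2) (2 * k - 2) * (c * (w * w) ^ k)) (seq 1 n)).
      * apply lsum_le; intros k Hk; apply in_seq in Hk.
        apply Rmult_le_compat_l; [apply wbin_nonneg | apply H; lia].
      * rewrite lsum_wbin_pow.
        replace (c' * (2 + w) ^ n) with (c * (w * w) * (2 + w) ^ (n - 2)).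
        { apply Rmult_le_compat_l; [apply Rmult_le_pos; nra|].
          apply wbin_even_le; [lia | lra]. }
        replace n with (n - 2 + 2)%nat at 2 by lia.
        unfold c'; rewrite pow_add; field; lra.
Qed.

Lemma growth_prune_transform (z z' : nat -> R) (rho : R) : 0 < rho ->
  prune_transform z z' -> growth z rho -> growth z' (2 + sqrt rho).
Proof.
  intros Hrho HP [Hge Hle].
  pose proof (sqrt_lt_R0 rho Hrho) as Hs; pose proof (sqrt_sqrt rho ltac:(lra)) as Hss.
  set (q := sqrt rho) in *; split; intros s Hsr.
  - set (w := Rmax (q / 2) (s - 2)).
    assert (Hw : 0 < w < q).
    { unfold w; split; [eapply Rlt_le_trans; [|apply Rmax_l]; lra|].
      apply Rmax_lub_lt; lra. }
    apply growth_ge_mono with (2 + w).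
    + pose proof (Rmax_r (q / 2) (s - 2)); fold w in H; lra.
    + apply (prune_transform_ge z); [assumption | lra |].
      apply Hge; nra.
  - replace s with (2 + (s - 2)) by ring.
    apply (prune_transform_le z); [assumption | lra |].
    apply Hle; nra.
Qed.

(** * Growth rate of the number of trees *)

Definition num_trees (n : nat) : R := INR (length (Omega n)).

Lemma lsum_Omega_pos (f : tree -> R) (n : nat) : (1 <= n)%nat ->
  (forall t, 0 < f t) -> 0 < lsum f (Omega n).
Proof. intros Hn; apply lsum_pos; now apply Omega_nonempty. Qed.

Lemma num_trees_pos (n : nat) : (1 <= n)%nat -> 0 < num_trees n.
Proof.
  intros Hn; unfold num_trees; rewrite <- lsum_one.
  apply lsum_Omega_pos; [assumption | intros; lra].
Qed.

Lemma prune_transform_lsum (F F' : tree -> R) :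
  (forall t, 0 < F' t) -> (forall t, t <> Leaf -> F' t = F (prune t)) ->
  prune_transform (fun n => lsum F (Omega n)) (fun n => lsum F' (Omega n)).
Proof.
  intros Hpos H; split; [now apply lsum_Omega_pos|].
  intros n Hn; rewrite <- lsum_prune by lia.
  apply lsum_ext_in; intros t Ht; apply H; now apply (Omega_not_Leaf n).
Qed.

Lemma prune_transform_num_trees : prune_transform num_trees num_trees.
Proof.
  destruct (prune_transform_lsum (fun _ => 1) (fun _ => 1)) as [H1 H2];
    [intros; lra | reflexivity |].
  unfold num_trees; split.
  - now rewrite <- lsum_one.
  - intros n Hn; rewrite <- lsum_one, H2 by assumption.
    now apply lsum_ext_in; intros; rewrite lsum_one.
Qed.

(** The rate 4 is fixed by the transform, so a bound of the form [4 ^ n / 4] reproduces itself, with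
    [w = 2]. *)
Lemma num_trees_le (n : nat) : (1 <= n)%nat -> num_trees n <= 4 ^ n / 4.
Proof.
  induction n as [n IH] using (well_founded_induction lt_wf); intros Hn.
  destruct (Nat.eq_dec n 1) as [->|Hn1]; [unfold num_trees; simpl; lra|].
  rewrite (proj2 prune_transform_num_trees) by lia.
  apply Rle_trans with
    (lsum (fun k => wbin (n - 2) (2 * k - 2) * (/ 4 * (2 * 2) ^ k)) (seq 1 n)).
  - apply lsum_le; intros k Hk; apply in_seq in Hk.
    (* The induction hypothesis does not reach [k = n], but there the weight is zero. *)
    destruct (le_lt_dec n k) as [Hkn|Hkn].
    + rewrite wbin_zero by lia; lra.
    + apply Rmult_le_compat_l; [apply wbin_nonneg|].
      replace (2 * 2) with 4 by ring.
      rewrite Rmult_comm; apply IH; lia.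
  - rewrite lsum_wbin_pow.
    pose proof (wbin_even_le n (n - 2) 2 ltac:(lia) ltac:(lra)) as H.
    replace (2 + 2) with 4 in H by ring.
    replace n with (n - 2 + 2)%nat at 3 by lia.
    rewrite pow_add.
    pose proof (pow_le 4 (n - 2) ltac:(lra)).
    simpl (4 ^ 2); lra.
Qed.

(* The exponential growth rate of the Catalan numbers is bounded below by iterating
   rho -> 2 + sqrt rho from rho = 1; the fixed point is 4. *)
Lemma num_trees_ge (j : nat) : growth_ge num_trees (4 - 3 * / 2 ^ j).
Proof.
  induction j as [|j IH].
  - exists 1; split; [lra|]; intros n Hn.
    replace (4 - 3 * / 2 ^ 0) with 1 by (simpl; field).
    rewrite pow1, Rmult_1_l; unfold num_trees.
    pose proof (Omega_nonempty n Hn); destruct (Omega n); [easy|].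
    change (length (t :: l)) with (S (length l)); rewrite S_INR.
    pose proof (pos_INR (length l)); lra.
  - set (e := / 2 ^ j) in IH.
    assert (He : 0 < e <= 1).
    { unfold e; split; [apply Rinv_0_lt_compat, pow_lt; lra|].
      rewrite <- Rinv_1; apply Rinv_le_contravar; [lra|]; apply pow_R1_Rle; lra. }
    replace (/ 2 ^ S j) with (e / 2)
      by (unfold e; simpl; field; apply pow_nonzero; lra).
    apply growth_ge_mono with (2 + sqrt (4 - 3 * e)).
    + split; [lra|].
      (* The distance to 4 is at least halved: the square of [2 - 3 * e / 2] is
         [4 - 6 * e + 9 * e ^ 2 / 4], at most [4 - 3 * e] because [e <= 1]. *)
      assert (2 - 3 * e / 2 <= sqrt (4 - 3 * e)); [|lra].
      destruct (Rle_dec 0 (2 - 3 * e / 2)).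
      * rewrite <- (sqrt_square (2 - 3 * e / 2)) by assumption.
        apply sqrt_le_1_alt; nra.
      * pose proof (sqrt_pos (4 - 3 * e)); lra.
    + apply (prune_transform_ge num_trees); [exact prune_transform_num_trees| |].
      * apply sqrt_lt_R0; lra.
      * rewrite sqrt_sqrt by lra; assumption.
Qed.

Lemma growth_num_trees : growth num_trees 4.
Proof.
  split; intros s Hs.
  - destruct (pow_lt_1_zero (/ 2) ltac:(rewrite Rabs_pos_eq; lra) ((4 - s) / 3) ltac:(lra))
      as [j Hj].
    specialize (Hj j (le_n j)); rewrite pow_inv, Rabs_pos_eq in Hj
      by (left; apply Rinv_0_lt_compat, pow_lt; lra).
    apply growth_ge_mono with (4 - 3 * / 2 ^ j); [lra | apply num_trees_ge].
  - apply growth_le_mono with 4; [lra|].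
    exists (/ 4); split; [lra|]; intros n Hn.
    rewrite Rmult_comm; now apply num_trees_le.
Qed.

(** * Growth rates of the exponential sums of branch counts *)

Lemma phi_alt (x : R) : phi x = ln ((1 + exp (x / 2)) / 2).
Proof.
  unfold phi, cosh; rewrite <- (ln_exp (x / 4)) at 1.
  pose proof (exp_pos (x / 4)); pose proof (exp_pos (- (x / 4))).
  rewrite <- ln_mult by lra; f_equal.
  replace (x / 2) with (x / 4 + x / 4) by lra; rewrite exp_plus.
  assert (exp (x / 4) * exp (- (x / 4)) = 1)
    by (rewrite <- exp_plus, Rplus_opp_r; apply exp_0).
  lra.
Qed.

(** The substitution [rho = 4 * exp x] conjugates the rate map [2 + sqrt rho] to [phi]. *)
Lemma exp_phi (x : R) : 4 * exp (phi x) = 2 + sqrt (4 * exp x).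
Proof.
  pose proof (exp_pos (x / 2)).
  rewrite phi_alt, exp_ln by lra.
  replace (4 * exp x) with ((2 * exp (x / 2)) * (2 * exp (x / 2))).
  - rewrite sqrt_square by lra; lra.
  - replace x with (x / 2 + x / 2) at 3 by lra; rewrite exp_plus; ring.
Qed.

Lemma exp_pow (x : R) (n : nat) : exp x ^ n = exp (INR n * x).
Proof.
  induction n as [|n IH]; [simpl; now rewrite Rmult_0_l, exp_0|].
  rewrite S_INR; simpl; rewrite IH, <- exp_plus; f_equal; ring.
Qed.

(** Not yet divided by the number of trees. The index is shifted: [r] refers to branches of order
    [r + 1], so [r = 0] counts leaves. *)
Definition mgf_sum (r : nat) (xi : R) (n : nat) : R :=
  lsum (fun t => exp (xi * INR (S_order (S r) t))) (Omega n).

Lemma growth_mgf_sum (r : nat) (xi : R) :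
  growth (mgf_sum r xi) (4 * exp (phi_iter r xi)).
Proof.
  induction r as [|r IH].
  - assert (E : forall n, mgf_sum 0 xi n = exp xi ^ n * num_trees n).
    { intros n; unfold mgf_sum, num_trees; rewrite <- lsum_one, <- lsum_scal.
      apply lsum_ext_in; intros t Ht; rewrite S_order_1, (leaves_Omega n t Ht).
      now rewrite Rmult_1_r, exp_pow, Rmult_comm. }
    simpl; pose proof (exp_pos xi).
    (* For [r = 0] the branch count is [n] on all of [Omega n], so the sum is the tree count with
       its rate rescaled by [exp xi]. *)
    assert (Hs : forall s n, s ^ n = exp xi ^ n * (s / exp xi) ^ n)
      by (intros; rewrite <- Rpow_mult_distr; f_equal; field; lra).
    destruct growth_num_trees as [Hge Hle]; split; intros s Hs'.
    + destruct (Hge (s / exp xi)) as [c [Hc H1]].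
      { split; [apply Rdiv_lt_0_compat; lra|].
        apply Rmult_lt_reg_r with (exp xi); [assumption|].
        unfold Rdiv; rewrite Rmult_assoc, Rinv_l; lra. }
      exists c; split; [assumption|]; intros n Hn; rewrite E, (Hs s).
      rewrite <- (Rmult_assoc c), (Rmult_comm c), Rmult_assoc.
      apply Rmult_le_compat_l; [apply pow_le; lra | now apply H1].
    + destruct (Hle (s / exp xi)) as [c [Hc H1]].
      { apply Rmult_lt_reg_r with (exp xi); [assumption|].
        unfold Rdiv; rewrite Rmult_assoc, Rinv_l; lra. }
      exists c; split; [assumption|]; intros n Hn; rewrite E, (Hs s).
      rewrite <- (Rmult_assoc c), (Rmult_comm c), Rmult_assoc.
      apply Rmult_le_compat_l; [apply pow_le; lra | now apply H1].
  - simpl phi_iter; rewrite exp_phi.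
    apply growth_prune_transform with (mgf_sum r xi); [| |assumption].
    + pose proof (exp_pos (phi_iter r xi)); lra.
    + apply (prune_transform_lsum (fun t => exp (xi * INR (S_order (S r) t)))
               (fun t => exp (xi * INR (S_order (S (S r)) t)))).
      * intros; apply exp_pos.
      * intros t Ht; now rewrite S_order_prune.
Qed.

Lemma eventually_div_lt (a e : R) : 0 < e ->
  exists N, (1 <= N)%nat /\ forall n, (N <= n)%nat -> a < e * INR n.
Proof.
  intros He; destruct (INR_unbounded (a / e)) as [N HN].
  exists (S N); split; [lia|]; intros n Hn.
  apply Rmult_lt_compat_r with (r := e) in HN; [|assumption].
  unfold Rdiv in HN; rewrite Rmult_assoc, Rinv_l, Rmult_1_r in HN by lra.
  apply Rlt_le_trans with (INR N * e); [assumption|].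
  rewrite Rmult_comm; apply Rmult_le_compat_l; [lra|]; apply le_INR; lia.
Qed.

(** Half of [e] separates the rate from [exp L]; the other half absorbs the multiplicative constant
    for large [n]. *)
Lemma growth_exp_bounds (z : nat -> R) (L e : R) : growth z (exp L) -> 0 < e ->
  exists N, forall n, (N <= n)%nat ->
    exp (INR n * (L - e)) <= z n <= exp (INR n * (L + e)).
Proof.
  intros [Hge Hle] He.
  destruct (Hge (exp (L - e / 2))) as [c [Hc Hlow]].
  { split; [apply exp_pos | apply exp_increasing; lra]. }
  destruct (Hle (exp (L + e / 2))) as [C [HC Hup]].
  { apply exp_increasing; lra. }
  destruct (eventually_div_lt (- ln c) (e / 2) ltac:(lra)) as [N1 [HN1 H1]].
  destruct (eventually_div_lt (ln C) (e / 2) ltac:(lra)) as [N2 [HN2 H2]].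
  exists (N1 + N2)%nat; intros n Hn.
  specialize (H1 n ltac:(lia)); specialize (H2 n ltac:(lia)).
  split.
  - eapply Rle_trans; [|apply Hlow; lia].
    rewrite <- (exp_ln c) by assumption; rewrite exp_pow, <- exp_plus.
    left; apply exp_increasing; lra.
  - eapply Rle_trans; [apply Hup; lia|].
    rewrite <- (exp_ln C) by assumption; rewrite exp_pow, <- exp_plus.
    left; apply exp_increasing; lra.
Qed.

(** * Large deviations of tilted means *)

Definition mean (n : nat) (f : tree -> R) : R := lsum f (Omega n) / num_trees n.

Lemma mean_le (n : nat) (f g : tree -> R) : (1 <= n)%nat ->
  (forall t, f t <= g t) -> mean n f <= mean n g.
Proof.
  intros Hn H; apply Rmult_le_compat_r.
  - left; apply Rinv_0_lt_compat; now apply num_trees_pos.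
  - now apply lsum_le.
Qed.

Lemma mean_scal (n : nat) (c : R) (f : tree -> R) :
  mean n (fun t => c * f t) = c * mean n f.
Proof. unfold mean; rewrite lsum_scal; unfold Rdiv; ring. Qed.

Lemma mean_plus (n : nat) (f g : tree -> R) :
  mean n (fun t => f t + g t) = mean n f + mean n g.
Proof. unfold mean; rewrite lsum_plus; unfold Rdiv; ring. Qed.

Lemma mean_ext (n : nat) (f g : tree -> R) :
  (forall t, f t = g t) -> mean n f = mean n g.
Proof. intros H; unfold mean; f_equal; now apply lsum_ext_in. Qed.

Lemma prob_mean (n : nat) (A : tree -> bool) :
  prob n A = mean n (fun t => if A t then 1 else 0).
Proof. unfold prob, mean; now rewrite lsum_filter. Qed.

(** Convergence of the normalised log-moment generating function to [Lam], in exponentiated form so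
    that no logarithms are handled. *)
Definition log_mgf_limit (X : nat -> tree -> R) (Lam : R -> R) : Prop :=
  forall xi e, 0 < e -> exists N, forall n, (N <= n)%nat ->
    exp (INR n * (Lam xi - e)) <= mean n (fun t => exp (INR n * (xi * X n t)))
      <= exp (INR n * (Lam xi + e)).

Lemma log_mgf_limit_S_order (r : nat) :
  log_mgf_limit (fun n t => INR (S_order (r + 1) t) / INR n) (phi_iter r).
Proof.
  intros xi e He.
  assert (H4 : 4 = exp (ln 4)) by (rewrite exp_ln; lra).
  pose proof (growth_mgf_sum r xi) as HZ.
  rewrite H4, <- exp_plus in HZ.
  pose proof growth_num_trees as Ha; rewrite H4 in Ha.
  destruct (growth_exp_bounds _ _ (e / 2) HZ ltac:(lra)) as [N1 H1].
  destruct (growth_exp_bounds _ _ (e / 2) Ha ltac:(lra)) as [N2 H2].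
  exists (S (N1 + N2)); intros n Hn.
  specialize (H1 n ltac:(lia)); specialize (H2 n ltac:(lia)).
  pose proof (num_trees_pos n ltac:(lia)) as Hpos.
  assert (E : mean n (fun t => exp (INR n * (xi * (INR (S_order (r + 1) t) / INR n))))
              = mgf_sum r xi n / num_trees n).
  { unfold mean, mgf_sum; f_equal; apply lsum_ext_in; intros t _.
    replace (r + 1)%nat with (S r) by lia; f_equal; field.
    apply not_0_INR; lia. }
  rewrite E; split.
  - apply Rmult_le_reg_r with (num_trees n); [assumption|].
    unfold Rdiv; rewrite Rmult_assoc, Rinv_l, Rmult_1_r by lra.
    eapply Rle_trans; [|apply H1].
    eapply Rle_trans; [apply Rmult_le_compat_l; [left; apply exp_pos | apply H2]|].
    rewrite <- exp_plus; right; f_equal; field.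
  - apply Rmult_le_reg_r with (num_trees n); [assumption|].
    unfold Rdiv; rewrite Rmult_assoc, Rinv_l, Rmult_1_r by lra.
    eapply Rle_trans; [apply H1|].
    eapply Rle_trans; [|apply Rmult_le_compat_l; [left; apply exp_pos | apply H2]].
    rewrite <- exp_plus; right; f_equal; field.
Qed.

Lemma log_mgf_limit_opp (X : nat -> tree -> R) (Lam : R -> R) :
  log_mgf_limit X Lam -> log_mgf_limit (fun n t => - X n t) (fun xi => Lam (- xi)).
Proof.
  intros H xi e He; destruct (H (- xi) e He) as [N HN]; exists N; intros n Hn.
  rewrite (mean_ext _ _ (fun t => exp (INR n * (- xi * X n t)))); [now apply HN|].
  intros t; f_equal; ring.
Qed.

Lemma exp_le (x y : R) : x <= y -> exp x <= exp y.
Proof. intros [H | ->]; [left; now apply exp_increasing | right; reflexivity]. Qed.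

(** Pointwise, the indicator of [y < X] is at most [exp (n * xi * (X - y))] because [xi >= 0]. *)
Lemma chernoff_upper (X : nat -> tree -> R) (n : nat) (y xi : R) :
  (1 <= n)%nat -> 0 <= xi ->
  prob n (fun t => Rltb y (X n t)) <=
  exp (- (INR n * (xi * y))) * mean n (fun t => exp (INR n * (xi * X n t))).
Proof.
  intros Hn Hxi; rewrite prob_mean, <- mean_scal; apply mean_le; [assumption|].
  intros t; rewrite <- exp_plus; unfold Rltb.
  destruct (Rlt_dec y (X n t)).
  - rewrite <- exp_0; apply exp_le.
    replace (_ + _) with (INR n * (xi * (X n t - y))) by ring.
    apply Rmult_le_pos; [apply pos_INR | apply Rmult_le_pos; lra].
  - left; apply exp_pos.
Qed.

(* Under the tilt by xi1, the values of X outside (y, z] are charged to the tilts by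
   xi2 > xi1 (those above z) and by xi0 < xi1 (those below y). *)
Lemma tilted_lower (X : nat -> tree -> R) (n : nat) (y z xi0 xi1 xi2 : R) :
  (1 <= n)%nat -> 0 <= xi1 -> xi0 <= xi1 <= xi2 ->
  exp (- (INR n * (xi1 * z))) *
   (mean n (fun t => exp (INR n * (xi1 * X n t)))
    + - exp (- (INR n * ((xi2 - xi1) * z))) * mean n (fun t => exp (INR n * (xi2 * X n t)))
    + - exp (INR n * ((xi1 - xi0) * y)) * mean n (fun t => exp (INR n * (xi0 * X n t))))
  <= prob n (fun t => Rltb y (X n t)).
Proof.
  intros Hn Hxi1 Hxi; rewrite prob_mean, <- !mean_scal, <- !mean_plus, <- mean_scal.
  apply mean_le; [assumption|]; intros t.
  rewrite !Ropp_mult_distr_l_reverse, <- !exp_plus.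
  pose proof (pos_INR n) as Hp.
  set (x := X n t); unfold Rltb.
  set (a := exp (INR n * (xi1 * x))).
  set (b := exp (_ + INR n * (xi2 * x))).
  set (c := exp (_ + INR n * (xi0 * x))).
  assert (0 < b) by apply exp_pos; assert (0 < c) by apply exp_pos.
  set (f := exp (- (INR n * (xi1 * z)))).
  assert (Hf : 0 < f) by apply exp_pos.
  assert (Hac : x <= y -> a <= c).
  { intros Hx; apply exp_le.
    assert (0 <= INR n * ((xi1 - xi0) * (y - x)))
      by (apply Rmult_le_pos; [assumption | apply Rmult_le_pos; lra]).
    lra. }
  assert (Hab : z <= x -> a <= b).
  { intros Hx; apply exp_le.
    assert (0 <= INR n * ((xi2 - xi1) * (x - z)))
      by (apply Rmult_le_pos; [assumption | apply Rmult_le_pos; lra]).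
    lra. }
  assert (Hfa : x <= z -> f * a <= 1).
  { intros Hx; unfold f, a; rewrite <- exp_plus, <- exp_0; apply exp_le.
    assert (0 <= INR n * (xi1 * (z - x)))
      by (apply Rmult_le_pos; [assumption | apply Rmult_le_pos; lra]).
    lra. }
  (* Three ranges: above [z] the term [b] outweighs [a], between [y] and [z] the factor [f] brings
     [a] below 1, and up to [y] the term [c] outweighs [a]. *)
  destruct (Rlt_dec y x) as [Hyx|Hyx].
  - destruct (Rle_dec z x) as [Hzx|Hzx].
    + specialize (Hab Hzx); nra.
    + apply Rle_trans with (f * a); [apply Rmult_le_compat_l; lra | apply Hfa; lra].
  - specialize (Hac ltac:(lra)); rewrite <- (Rmult_0_r f).
    apply Rmult_le_compat_l; lra.
Qed.

(** The lower bound makes [u n] positive, so logarithms may be taken of both inequalities. *)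
Lemma exp_bounds_Un_cv (u : nat -> R) (L : R) :
  (forall e, 0 < e -> exists N, forall n, (N <= n)%nat ->
     exp (INR n * (L - e)) <= u n <= exp (INR n * (L + e))) ->
  Un_cv (fun n => ln (u n) / INR n) L.
Proof.
  intros H e He; destruct (H (e / 2) ltac:(lra)) as [N HN].
  exists (S N); intros n Hn.
  destruct (HN n ltac:(lia)) as [H1 H2].
  assert (Hn0 : 0 < INR n) by (apply lt_0_INR; lia).
  pose proof (exp_pos (INR n * (L - e / 2))) as Hp.
  apply ln_le in H2; [|lra].
  apply ln_le in H1; [|assumption].
  rewrite ln_exp in H1, H2.
  assert (H3 : ln (u n) = ln (u n) / INR n * INR n) by (field; lra).
  rewrite H3 in H1, H2; rewrite (Rmult_comm (INR n)) in H1, H2.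
  apply Rmult_le_reg_r in H1, H2; try assumption.
  unfold Rdist; apply Rabs_def1; lra.
Qed.

(** * Upper tail rate for a strictly convex limit [Lam] with derivative [D] *)

Section UpperTail.

Variables (X : nat -> tree -> R) (Lam D : R -> R).
Hypothesis Hmgf : log_mgf_limit X Lam.
Hypothesis Hder : forall x, derivable_pt_lim Lam x (D x).
Hypothesis Hcont : continuity D.
Hypothesis Hincr : forall x x', x < x' -> D x < D x'.

Lemma increment_bounds (a b : R) : a < b ->
  D a * (b - a) < Lam b - Lam a < D b * (b - a).
Proof.
  intros Hab; destruct (MVT_cor2 Lam D a b Hab) as [c [Hc1 Hc2]]; [auto|].
  rewrite Hc1; pose proof (Hincr a c ltac:(lra)); pose proof (Hincr c b ltac:(lra)).
  split; apply Rmult_lt_compat_r; lra.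
Qed.

(** By strict convexity of [Lam], the critical point [x0] of [D x0 * x - Lam x] is its maximiser. *)
Lemma legendre_max (x0 x : R) : D x0 * x - Lam x <= D x0 * x0 - Lam x0.
Proof.
  destruct (Rtotal_order x x0) as [H|[->|H]]; [|lra|];
    pose proof (increment_bounds _ _ H); lra.
Qed.

(** Tilting by [x0 + h] and cutting off at the slope [D (x0 + 2 * h)] yields the exponent on the
    right; it is continuous in [h] and optimal at [h = 0], so a small [h] costs less than [e]. *)
Lemma nearby_tilts (x0 e : R) : 0 < e -> exists h, 0 < h /\
  Lam x0 - x0 * D x0 - e < Lam (x0 + h) - (x0 + h) * D (x0 + 2 * h).
Proof.
  intros He; set (g := fun h => Lam (x0 + h) - (x0 + h) * D (x0 + 2 * h)).
  assert (Hg : continuity_pt g 0).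
  { assert (Hid : forall a, continuity_pt (fun h => x0 + a * h) 0).
    { intros a; apply derivable_continuous_pt; reg. }
    assert (Hid1 : continuity_pt (fun h => x0 + h) 0)
      by (apply derivable_continuous_pt; reg).
    apply (continuity_pt_minus (fun h => Lam (x0 + h)) (fun h => (x0 + h) * D (x0 + 2 * h))).
    - apply (continuity_pt_comp (fun h => x0 + h) Lam); [assumption|].
      apply derivable_continuous_pt; eexists; apply Hder.
    - apply (continuity_pt_mult (fun h => x0 + h) (fun h => D (x0 + 2 * h))); [assumption|].
      apply (continuity_pt_comp (fun h => x0 + 2 * h) D); [apply Hid | apply Hcont]. }
  destruct (Hg e He) as [alp [Halp H]].
  exists (alp / 2); split; [lra|].
  specialize (H (alp / 2)); simpl in H; unfold Rdist in H.
  assert (H' : Rabs (g (alp / 2) - g 0) < e).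
  { apply H; split; [split; [exact I | lra]|].
    rewrite Rabs_pos_eq; lra. }
  apply Rabs_def2 in H'; unfold g in H'.
  rewrite Rmult_0_r, !Rplus_0_r in H'; lra.
Qed.

(** The Chernoff bound at [x0] gives the upper estimate. For the lower one, the tilt by [x1] has
    slope [D x1] strictly between [y = D x0] and [z = D x2], so it concentrates [X] there. *)
Lemma upper_tail_rate (x0 : R) : 0 < x0 ->
  Un_cv (fun n => ln (prob n (fun t => Rltb (D x0) (X n t))) / INR n)
        (- (D x0 * x0 - Lam x0)).
Proof.
  intros Hx0; apply exp_bounds_Un_cv; intros e He.
  set (y := D x0).
  destruct (nearby_tilts x0 (e / 2) ltac:(lra)) as [h [Hh Hrate]].
  set (x1 := x0 + h) in *; set (x2 := x0 + 2 * h) in *; set (z := D x2) in *.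
  pose proof (increment_bounds x0 x1 ltac:(unfold x1; lra)) as [Hg0 _].
  pose proof (increment_bounds x1 x2 ltac:(unfold x1, x2; lra)) as [_ Hg2].
  fold y in Hg0, Hrate; fold z in Hg2.
  (* [g0] and [g2] are the exponential rates by which the charges for values below [y] and above [z]
     fall short of the tilted mass; strict convexity makes them positive. *)
  set (g0 := Lam x1 - Lam x0 - y * (x1 - x0)) in *.
  set (g2 := z * (x2 - x1) - (Lam x2 - Lam x1)) in *.
  (* Each charge needs [3 * d] of its gap: two moment errors and the factor [q]. The final exponent
     loses [2 * d], at most [e / 2]. *)
  set (d := Rmin (e / 4) (Rmin (g0 / 4) (g2 / 4))).
  assert (Hd : 0 < d /\ d <= e / 4 /\ d <= g0 / 4 /\ d <= g2 / 4).
  { unfold d; repeat split.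
    - repeat apply Rmin_glb_lt; unfold g0, g2; lra.
    - apply Rmin_l.
    - eapply Rle_trans; [apply Rmin_r | apply Rmin_l].
    - eapply Rle_trans; [apply Rmin_r | apply Rmin_r]. }
  destruct Hd as [Hd0 [Hd1 [Hd2 Hd3]]].
  destruct (Hmgf x0 d Hd0) as [N0 H0], (Hmgf x1 d Hd0) as [N1 H1],
           (Hmgf x2 d Hd0) as [N2 H2].
  (* This makes [q < / 4]: the two charges take at most half of [m], and what remains exceeds
     [m * q]. *)
  destruct (eventually_div_lt (ln 4) d Hd0) as [N3 [_ H3]].
  exists (S (N0 + N1 + N2 + N3)); intros n Hn.
  specialize (H0 n ltac:(lia)); specialize (H1 n ltac:(lia));
    specialize (H2 n ltac:(lia)); specialize (H3 n ltac:(lia)).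
  assert (Hn0 : 0 < INR n) by (apply lt_0_INR; lia).
  split.
  - eapply Rle_trans; [|apply (tilted_lower X n y z x0 x1 x2); unfold x1, x2; lra || lia].
    set (M0 := mean n (fun t => exp (INR n * (x0 * X n t)))) in *.
    set (M1 := mean n (fun t => exp (INR n * (x1 * X n t)))) in *.
    set (M2 := mean n (fun t => exp (INR n * (x2 * X n t)))) in *.
    set (m := exp (INR n * (Lam x1 - d))) in *.
    set (q := exp (- (d * INR n))).
    assert (Hq : 0 < q < / 4).
    { split; [apply exp_pos|].
      rewrite <- (exp_ln (/ 4)) by lra; apply exp_increasing.
      rewrite ln_Rinv by lra; lra. }
    assert (Hm : 0 < m) by apply exp_pos.
    assert (HM2 : exp (- (INR n * ((x2 - x1) * z))) * M2 <= m * q).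
    { eapply Rle_trans; [apply Rmult_le_compat_l; [left; apply exp_pos | apply H2]|].
      unfold m, q; rewrite <- !exp_plus; apply exp_le.
      assert (0 <= INR n * (g2 - 3 * d)) by (apply Rmult_le_pos; lra).
      unfold g2 in *; lra. }
    assert (HM0 : exp (INR n * ((x1 - x0) * y)) * M0 <= m * q).
    { eapply Rle_trans; [apply Rmult_le_compat_l; [left; apply exp_pos | apply H0]|].
      unfold m, q; rewrite <- !exp_plus; apply exp_le.
      assert (0 <= INR n * (g0 - 3 * d)) by (apply Rmult_le_pos; lra).
      unfold g0 in *; lra. }
    apply Rle_trans with (exp (- (INR n * (x1 * z))) * (m * q)).
    + unfold m, q; rewrite <- !exp_plus; apply exp_le.
      assert (0 <= INR n * (e / 2 - 2 * d + (Lam x1 - x1 * z - (Lam x0 - x0 * y - e / 2))))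
        by (apply Rmult_le_pos; lra).
      lra.
    + apply Rmult_le_compat_l; [left; apply exp_pos|]; nra.
  - eapply Rle_trans; [apply (chernoff_upper X n y x0); lra || lia|].
    eapply Rle_trans; [apply Rmult_le_compat_l; [left; apply exp_pos | apply H0]|].
    rewrite <- exp_plus; apply exp_le.
    assert (0 <= INR n * (e - d)) by (apply Rmult_le_pos; lra).
    lra.
Qed.

End UpperTail.

(** * The iterates of phi *)

(** The derivative of [phi]: half the logistic function of [x / 2], in a form that shows its
    monotonicity. *)
Definition dphi (x : R) : R := (1 - / (1 + exp (x / 2))) / 2.

Fixpoint dphi_iter (r : nat) (x : R) : R :=
  match r with O => 1 | S r' => dphi (phi_iter r' x) * dphi_iter r' x end.

Lemma phi_derive (x : R) : derivable_pt_lim phi x (dphi x).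
Proof.
  apply is_derive_Reals; apply (is_derive_ext (fun x => ln ((1 + exp (x / 2)) / 2))).
  - intros; symmetry; apply phi_alt.
  - pose proof (exp_pos (x / 2)); unfold dphi; auto_derive.
    + lra.
    + change (x * / 2) with (x / 2); field; lra.
Qed.

Lemma phi_iter_derive (r : nat) (x : R) :
  derivable_pt_lim (phi_iter r) x (dphi_iter r x).
Proof.
  induction r as [|r IH]; simpl.
  - apply derivable_pt_lim_id.
  - apply (derivable_pt_lim_comp (phi_iter r) phi); [assumption | apply phi_derive].
Qed.

Lemma dphi_pos (x : R) : 0 < dphi x.
Proof.
  unfold dphi; pose proof (exp_pos (x / 2)).
  assert (/ (1 + exp (x / 2)) < 1); [|lra].
  rewrite <- Rinv_1; apply Rinv_lt_contravar; lra.
Qed.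

Lemma dphi_increasing (x x' : R) : x < x' -> dphi x < dphi x'.
Proof.
  intros H; unfold dphi; pose proof (exp_pos (x / 2)).
  assert (exp (x / 2) < exp (x' / 2)) by (apply exp_increasing; lra).
  assert (/ (1 + exp (x' / 2)) < / (1 + exp (x / 2))); [|lra].
  apply Rinv_lt_contravar; [apply Rmult_lt_0_compat|]; lra.
Qed.

Lemma phi_increasing (x x' : R) : x < x' -> phi x < phi x'.
Proof.
  intros H; rewrite !phi_alt; pose proof (exp_pos (x / 2)).
  assert (exp (x / 2) < exp (x' / 2)) by (apply exp_increasing; lra).
  apply ln_increasing; lra.
Qed.

Lemma phi_iter_increasing (r : nat) (x x' : R) : x < x' -> phi_iter r x < phi_iter r x'.
Proof. intros H; induction r; simpl; [assumption | now apply phi_increasing]. Qed.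

Lemma dphi_iter_pos (r : nat) (x : R) : 0 < dphi_iter r x.
Proof.
  induction r; simpl; [lra | apply Rmult_lt_0_compat; [apply dphi_pos | assumption]].
Qed.

(** By the chain rule the derivative is a product of positive increasing factors. The index [S r]
    excludes the identity, whose derivative is constant. *)
Lemma dphi_iter_increasing (r : nat) (x x' : R) :
  x < x' -> dphi_iter (S r) x < dphi_iter (S r) x'.
Proof.
  intros H; induction r as [|r IH].
  - simpl; rewrite !Rmult_1_r; now apply dphi_increasing.
  - change (dphi (phi_iter (S r) x) * dphi_iter (S r) x <
            dphi (phi_iter (S r) x') * dphi_iter (S r) x').
    apply Rmult_gt_0_lt_compat; try assumption;
      [apply dphi_iter_pos | apply dphi_pos |].
    apply dphi_increasing; now apply phi_iter_increasing.
Qed.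

Lemma dphi_iter_continuity (r : nat) : continuity (dphi_iter r).
Proof.
  intros x; induction r as [|r IH].
  - apply continuity_pt_const; intros a b; reflexivity.
  - apply (continuity_pt_mult (fun x => dphi (phi_iter r x)) (dphi_iter r)); [|assumption].
    apply (continuity_pt_comp (phi_iter r) dphi).
    + apply derivable_continuous_pt; eexists; apply phi_iter_derive.
    + apply continuity_pt_filterlim, (ex_derive_continuous dphi).
      pose proof (exp_pos (phi_iter r x / 2)); unfold dphi; auto_derive; lra.
Qed.

(** * Slopes of the iterates: value at 0 and attained range *)

Lemma phi_0 : phi 0 = 0.
Proof. rewrite phi_alt, Rdiv_0_l, exp_0, <- ln_1; f_equal; field. Qed.

Lemma phi_iter_0 (r : nat) : phi_iter r 0 = 0.
Proof. induction r as [|r IH]; simpl; [reflexivity | now rewrite IH, phi_0]. Qed.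

(** The point 0 is fixed by [phi], with slope 1/4. The resulting value is the typical density, where
    the two tails meet. *)
Lemma dphi_iter_0 (r : nat) : dphi_iter r 0 = / 4 ^ r.
Proof.
  induction r as [|r IH]; simpl; [lra|].
  rewrite IH, phi_iter_0; unfold dphi; rewrite Rdiv_0_l, exp_0.
  field; apply pow_nonzero; lra.
Qed.

(** The two lower bounds are the asymptotes of [phi] at plus and minus infinity. *)
Lemma phi_ge (x : R) : x / 2 - ln 2 <= phi x /\ - ln 2 <= phi x.
Proof.
  rewrite phi_alt; pose proof (exp_pos (x / 2)).
  rewrite ln_div by lra; split.
  - rewrite <- (ln_exp (x / 2)) at 1; apply Rplus_le_compat_r, ln_le; lra.
  - rewrite <- (Rplus_0_l (- ln 2)), <- ln_1 at 1; apply Rplus_le_compat_r, ln_le; lra.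
Qed.

Lemma ln_2_pos : 0 < ln 2.
Proof. rewrite <- ln_1; apply ln_increasing; lra. Qed.

(** The additive loss evolves by [c -> c / 2 + ln 2], whose fixed point is [2 * ln 2]. *)
Lemma phi_iter_ge (r : nat) (x : R) : x * / 2 ^ r - 2 * ln 2 <= phi_iter r x.
Proof.
  pose proof ln_2_pos; induction r as [|r IH]; simpl; [lra|].
  destruct (phi_ge (phi_iter r x)) as [H1 _].
  rewrite Rinv_mult; lra.
Qed.

Lemma slope_above (r : nat) (y : R) : y < / 2 ^ r ->
  exists x, 0 < x /\ y < dphi_iter r x.
Proof.
  intros Hy; pose proof ln_2_pos.
  (* Chosen so that [b * (/ 2 ^ r - y)] exceeds [2 * ln 2]; the mean slope on the interval from 0 to
     [b] is then above [y]. *)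
  set (b := (2 * ln 2 + 1) / (/ 2 ^ r - y)).
  assert (Hb : 0 < b) by (apply Rdiv_lt_0_compat; lra).
  destruct (MVT_cor2 (phi_iter r) (dphi_iter r) 0 b Hb) as [c [Hc1 Hc2]];
    [intros; apply phi_iter_derive|].
  exists c; split; [lra|].
  rewrite phi_iter_0 in Hc1; pose proof (phi_iter_ge r b).
  assert (E : b * (/ 2 ^ r - y) = 2 * ln 2 + 1)
    by (unfold b; set (q := / 2 ^ r) in *; field; lra).
  apply Rmult_lt_reg_r with b; [assumption | lra].
Qed.

Lemma slope_below (r : nat) (y : R) : 0 < y ->
  exists x, x < 0 /\ dphi_iter (S r) x < y.
Proof.
  intros Hy; pose proof ln_2_pos.
  (* Since the iterate is at least [- ln 2], its mean slope between [- b] and 0 is at most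
     [ln 2 / b], hence below [y]. *)
  set (b := (ln 2 + 1) / y).
  assert (Hb : 0 < b) by (apply Rdiv_lt_0_compat; lra).
  destruct (MVT_cor2 (phi_iter (S r)) (dphi_iter (S r)) (- b) 0 ltac:(lra)) as [c [Hc1 Hc2]];
    [intros; apply phi_iter_derive|].
  exists c; split; [lra|].
  rewrite phi_iter_0 in Hc1; destruct (phi_ge (phi_iter r (- b))) as [_ H1].
  change (phi (phi_iter r (- b))) with (phi_iter (S r) (- b)) in H1.
  assert (E : b * y = ln 2 + 1) by (unfold b; field; lra).
  apply Rmult_lt_reg_r with b; [assumption | lra].
Qed.

Lemma slope_attained (r : nat) (a b y : R) : a < b ->
  dphi_iter r a < y < dphi_iter r b -> exists x, a < x < b /\ dphi_iter r x = y.
Proof.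
  intros Hab Hy.
  destruct (IVT_gen (dphi_iter r) a b y (dphi_iter_continuity r)) as [x [Hx E]].
  - rewrite Rmin_left, Rmax_right by lra; lra.
  - rewrite Rmin_left, Rmax_right in Hx by lra.
    exists x; split; [|assumption].
    assert (x <> a) by (intros ->; lra); assert (x <> b) by (intros ->; lra); lra.
Qed.

Lemma Legendre_dphi_iter (r : nat) (x : R) :
  Legendre (S r) (dphi_iter (S r) x) (dphi_iter (S r) x * x - phi_iter (S r) x).
Proof.
  split.
  - intros z [xi ->].
    apply legendre_max; [apply phi_iter_derive | apply dphi_iter_increasing].
  - intros b Hb; apply Hb; now exists x.
Qed.

Lemma Un_cv_ext (u v : nat -> R) (l : R) : (forall n, u n = v n) -> Un_cv u l -> Un_cv v l.
Proof.
  intros E H e He; destruct (H e He) as [N HN]; exists N; intros n Hn.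
  rewrite <- E; now apply HN.
Qed.

(** * The two tails of the branch counts *)

Theorem theorem2p2 (r : nat) (hr : (1 <= r)%nat) :
  (forall y : R, / 4 ^ r < y < / 2 ^ r ->
     exists I : R, Legendre r y I /\
       Un_cv (fun n => ln (prob n (fun t => Rltb y (INR (S_order (r + 1) t) / INR n))) / INR n)
             (- I))
  /\
  (forall y : R, 0 < y < / 4 ^ r ->
     exists I : R, Legendre r y I /\
       Un_cv (fun n => ln (prob n (fun t => Rltb (INR (S_order (r + 1) t) / INR n) y)) / INR n)
             (- I)).
Proof.
  pose proof (log_mgf_limit_S_order r) as Hmgf.
  destruct r as [|r]; [lia|]; split; intros y Hy.
  (* The slope at 0 is below [y] and some slope further right is above it, so [y] is the slope at
     some [x > 0], the maximiser in the Legendre transform. *)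
  - destruct (slope_above (S r) y ltac:(lra)) as [b [Hb Hyb]].
    destruct (slope_attained (S r) 0 b y Hb) as [x [Hx <-]];
      [rewrite dphi_iter_0; lra|].
    exists (dphi_iter (S r) x * x - phi_iter (S r) x).
    split; [apply Legendre_dphi_iter|].
    apply (upper_tail_rate (fun n t => INR (S_order (S r + 1) t) / INR n)
             (phi_iter (S r)) (dphi_iter (S r)) Hmgf);
      [apply phi_iter_derive | apply dphi_iter_continuity
      | apply dphi_iter_increasing | lra].
  - destruct (slope_below r y ltac:(lra)) as [a [Ha Hya]].
    destruct (slope_attained (S r) a 0 y Ha) as [x [Hx <-]];
      [rewrite dphi_iter_0; lra|].
    exists (dphi_iter (S r) x * x - phi_iter (S r) x).
    split; [apply Legendre_dphi_iter|].
    (* The derivative of the reflected limit. At the positive point [- x] it equals [- y], so the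
       upper tail of the negated count at that level is the lower tail wanted. *)
    set (D := fun xi => - dphi_iter (S r) (- xi)).
    apply log_mgf_limit_opp in Hmgf.
    assert (H : Un_cv (fun n => ln (prob n (fun t =>
                Rltb (D (- x)) (- (INR (S_order (S r + 1) t) / INR n)))) / INR n)
                (- (D (- x) * - x - phi_iter (S r) (- - x)))).
    { apply (upper_tail_rate _ (fun xi => phi_iter (S r) (- xi)) D Hmgf).
      - intros u; unfold D.
        replace (- dphi_iter (S r) (- u)) with (dphi_iter (S r) (- u) * -1) by ring.
        apply (derivable_pt_lim_comp Ropp (phi_iter (S r))); [|apply phi_iter_derive].
        apply is_derive_Reals; auto_derive; [exact I | ring].
      - intros u; apply (continuity_pt_opp (fun xi => dphi_iter (S r) (- xi))).
        apply (continuity_pt_comp Ropp (dphi_iter (S r))); [|apply dphi_iter_continuity].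
        apply derivable_continuous_pt; reg.
      - intros u v Huv; unfold D; apply Ropp_lt_contravar, dphi_iter_increasing; lra.
      - lra. }
    unfold D in H; rewrite !Ropp_involutive in H.
    replace (dphi_iter (S r) x * x) with (- dphi_iter (S r) x * - x) by ring.
    revert H; apply Un_cv_ext; intros n; f_equal; f_equal.
    rewrite !prob_mean; apply mean_ext; intros t; unfold Rltb.
    destruct (Rlt_dec (- _) (- _)), (Rlt_dec _ _); lra.
Qed.
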